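(* Let $F:\mathbb C^5\to\mathbb C$, $(a_0,a_1,a_2,a_3,x)\mapsto x^4 + a_3x^3 + a_2x^2 + a_1 x + a_0$. Then there is no continuous function $r:\mathbb R^4\to\mathbb C$ such that $F(M,r(M))=0$ for all $M=(a_0,a_1,a_2,a_3)\in\mathbb R^4$.
   Context: Here $F(M,x)$ with $M=(a_0,a_1,a_2,a_3)$ means $F(a_0,a_1,a_2,a_3,x)$. Continuity is with respect to the standard topologies of $\mathbb R^4$ and $\mathbb C$. *)

(* Defs.v *)
From Stdlib Require Import Reals.
From Coquelicot Require Import Coquelicot.

Open Scope C_scope.

Definition F (v : C * C * C * C * C) : C :=
  let '(a0, a1, a2, a3, x) := v in
  x ^ 4 + a3 * x ^ 3 + a2 * x ^ 2 + a1 * x + a0.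

(* [R * R * R * R] and [C = R * R] carry Coquelicot's product uniform structure
   (sup metric), which induces the standard topologies of R^4 and C. *)
Definition embed (M : R * R * R * R) : C * C * C * C :=
  let '(a0, a1, a2, a3) := M in (RtoC a0, RtoC a1, RtoC a2, RtoC a3).

(* Main.v *)
Require Import Defs.
From Stdlib Require Import Reals Lra.
From Coquelicot Require Import Coquelicot.

(** For [w = u + i v] on the unit circle, the real quartic with roots
    [2i +- sqrt w] and their conjugates is
    [x^4 + (8 - 2u) x^2 + 8v x + (17 + 8u)].  Its two roots in the upper half
    plane are exchanged when [w] runs once around the circle, and neither of
    them ever meets the real axis.  Reflecting a continuous root into the upper
    half plane and subtracting [2i] would therefore give a continuous square
    root of [w] on the whole circle, which does not exist. *)

Open Scope R_scope.

Definition loop (u v : R) : R * R * R * R := (17 + 8 * u, 8 * v, 8 - 2 * u, 0).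

(** With [x = p + i q] and [w = u + i v], the two factors are [(x - 2i)^2 - w] and
    [(x + 2i)^2 - conj w], written in coordinates. *)
Lemma F_loop_factor (u v p q : R) :
  u * u + v * v = 1 ->
  F (embed (loop u v), (p, q)) =
  Cmult (p * p - (q - 2) * (q - 2) - u, 2 * p * (q - 2) - v)
        (p * p - (q + 2) * (q + 2) - u, 2 * p * (q + 2) + v).
Proof.
intros huv.
apply injective_projections; simpl.
(* The constant term is [|4 + w|^2 = 16 + 8u + |w|^2]; the 17 hides [|w| = 1]. *)
- replace (17 + 8 * u) with (16 + 8 * u + (u * u + v * v)) by lra. ring.
- ring.
Qed.

Lemma Cmult_integral (z w : C) : Cmult z w = RtoC 0 -> z = RtoC 0 \/ w = RtoC 0.
Proof.
intros h.
destruct (Ceq_dec z (RtoC 0)) as [hz | hz]; [now left | right].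
destruct (Ceq_dec w (RtoC 0)) as [hw | hw]; [exact hw |].
now destruct (Cmult_neq_0 z w hz hw).
Qed.

(** The squared modulus is multiplicative: [(a^2 + b^2)^2 = (a^2 - b^2)^2 + (2ab)^2]. *)
Lemma sqrt_unit_norm (a b u v : R) :
  u * u + v * v = 1 -> a * a - b * b = u -> 2 * a * b = v -> a * a + b * b = 1.
Proof.
intros huv h1 h2.
assert (hn : (a * a + b * b) * (a * a + b * b) = 1) by (rewrite <- huv, <- h1, <- h2; ring).
assert (h0 : 0 <= a * a + b * b) by (apply Rplus_le_le_0_compat; apply Rle_0_sqr).
revert hn h0. generalize (a * a + b * b). intros n hn h0.
nra.
Qed.

Lemma F_loop_root (u v p q : R) :
  u * u + v * v = 1 ->
  F (embed (loop u v), (p, q)) = RtoC 0 ->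
  p * p - (Rabs q - 2) * (Rabs q - 2) = u /\ 2 * p * (Rabs q - 2) = v.
Proof.
intros huv h.
rewrite (F_loop_factor u v p q huv) in h.
destruct (Cmult_integral _ _ h) as [e | e]; injection e as e1 e2.
- assert (hn := sqrt_unit_norm p (q - 2) u v huv ltac:(lra) ltac:(lra)).
  (* The unit norm gives [|q - 2| <= 1], which fixes the sign of [q]. *)
  assert (0 < q) by nra.
  rewrite Rabs_pos_eq by lra. split; lra.
(* Here [(p, q + 2)] is a square root of [conj w], so [q] is negative and [|q| - 2 = -(q + 2)]:
   conjugating gives a square root of [w]. *)
- assert (hn := sqrt_unit_norm p (q + 2) u (- v) ltac:(lra) ltac:(lra) ltac:(lra)).
  assert (q < 0) by nra.
  rewrite Rabs_left by lra. split; lra.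
Qed.

Lemma continuous_pair {U V W : UniformSpace} (f : U -> V) (g : U -> W) (x : U) :
  continuous f x -> continuous g x -> continuous (fun y => (f y, g y)) x.
Proof.
intros hf hg.
apply filterlim_locally. intros eps.
generalize (proj1 (filterlim_locally _ _) hf eps) (proj1 (filterlim_locally _ _) hg eps).
intros h1 h2.
exact (filter_and _ _ h1 h2).
Qed.

Lemma continuous_loop (t : R) :
  continuous (fun t => loop (cos t) (sin t)) t.
Proof.
assert (hc : continuous cos t) by apply continuous_cos.
assert (hs : continuous sin t) by apply continuous_sin.
unfold loop.
repeat apply continuous_pair.
- apply (continuous_plus (fun _ => 17) (fun t => 8 * cos t)).
  + apply continuous_const.
  + now apply (continuous_scal_r 8 cos).
- now apply (continuous_scal_r 8 sin).
- apply (continuous_minus (fun _ => 8) (fun t => 2 * cos t)).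
  + apply continuous_const.
  + now apply (continuous_scal_r 2 cos).
- apply continuous_const.
Qed.

Lemma no_continuous_sqrt_on_circle (a b : R -> R) :
  (forall t, continuous a t) -> (forall t, continuous b t) ->
  a (2 * PI) = a 0 ->
  (forall t, a t * a t - b t * b t = cos t /\ 2 * a t * b t = sin t) ->
  False.
Proof.
intros ha hb hper hsq.
(* The real part of [(a + i b) e^(-it/2)]: its square is 1, but it changes sign
   between [0] and [2 PI]. *)
set (k := fun t => a t * cos (t / 2) + b t * sin (t / 2)).
assert (hk2 : forall t, k t * k t = 1).
{ intros t. unfold k.
  destruct (hsq t) as [h1 h2].
  assert (hn := sqrt_unit_norm _ _ _ _ (eq_trans (Rplus_comm _ _) (sin2_cos2 t)) h1 h2).
  assert (hcs := sin2_cos2 (t / 2)). unfold Rsqr in hcs.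
  assert (hc2 := cos_2a (t / 2)). assert (hs2 := sin_2a (t / 2)).
  replace (2 * (t / 2)) with t in hc2, hs2 by field.
  rewrite hc2 in h1. rewrite hs2 in h2.
  revert hn hcs h1 h2.
  generalize (a t), (b t), (cos (t / 2)), (sin (t / 2)).
  intros x y c s hn hcs h1 h2.
  replace ((x * c + y * s) * (x * c + y * s))
    with (x * x * (c * c) + (2 * x * y) * (c * s) + y * y * (s * s)) by ring.
  (* The squares agree because [x^2 + y^2 = c^2 + s^2] and [x^2 - y^2 = c^2 - s^2]. *)
  replace (x * x) with (c * c) by lra.
  replace (y * y) with (s * s) by lra.
  rewrite h2.
  transitivity ((s * s + c * c) * (s * s + c * c)); [ring | rewrite hcs; ring]. }
assert (hk : continuity k).
{ intros t. apply continuity_pt_filterlim.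
  assert (hh : continuous (fun t => t / 2) t).
  { apply (continuous_mult (fun t => t) (fun _ => / 2)).
    - apply continuous_id.
    - apply continuous_const. }
  apply (continuous_plus (fun t => a t * cos (t / 2)) (fun t => b t * sin (t / 2))).
  - apply (continuous_mult a (fun t => cos (t / 2))); [apply ha |].
    apply continuous_comp; [exact hh | apply continuous_cos].
  - apply (continuous_mult b (fun t => sin (t / 2))); [apply hb |].
    apply continuous_comp; [exact hh | apply continuous_sin]. }
assert (h0 : k 0 = a 0).
{ unfold k. replace (0 / 2) with 0 by field. rewrite cos_0, sin_0. ring. }
(* Over a full turn [e^(-it/2)] goes from 1 to -1, while [a] returns to its initial value. *)
assert (h1 : k (2 * PI) = - a 0).
{ unfold k. replace (2 * PI / 2) with PI by field. rewrite cos_PI, sin_PI, hper. ring. }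
destruct (IVT_gen k 0 (2 * PI) 0 hk) as [t [_ ht]].
- rewrite h0, h1. unfold Rmin, Rmax. destruct (Rle_dec (a 0) (- a 0)); lra.
- specialize (hk2 t). rewrite ht in hk2. lra.
Qed.

Theorem mainTheorem4 :
  ~ exists r : R * R * R * R -> C,
      (forall M : R * R * R * R, continuous r M) /\
      (forall M : R * R * R * R, F (embed M, r M) = RtoC 0).
Proof.
intros [r [hr hroot]].
set (g := fun t => r (loop (cos t) (sin t))).
assert (hg : forall t, continuous g t).
{ intros t. apply (continuous_comp (fun t => loop (cos t) (sin t)) r);
    [apply continuous_loop | apply hr]. }
(* [Rabs] performs the reflection, so continuity holds without knowing which half plane [r]
   selects. *)
apply (no_continuous_sqrt_on_circle (fun t => fst (g t)) (fun t => Rabs (snd (g t)) - 2)).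
- intros t. apply (continuous_comp g fst); [apply hg | apply continuous_fst].
- intros t.
  apply (continuous_minus (fun t => Rabs (snd (g t))) (fun _ => 2)); [| apply continuous_const].
  apply (continuous_comp (fun t => snd (g t)) Rabs); [| apply continuous_Rabs].
  apply (continuous_comp g snd); [apply hg | apply continuous_snd].
- unfold g. now rewrite cos_2PI, sin_2PI, cos_0, sin_0.
- intros t. apply F_loop_root.
  + rewrite Rplus_comm. apply sin2_cos2.
  + rewrite <- surjective_pairing. apply hroot.
Qed.
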